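(* Let $\mathbf{F}$ be an arbitrary field, let $(T,[\cdot,\cdot,\cdot],\alpha)$ be a multiplicative Hom-Lie triple system over $\mathbf{F}$, and let $V$ be an $\mathbf{F}$-vector space with $\alpha_V\in\mathrm{End}(V)$, regarded as the trivial $(T,[\cdot,\cdot,\cdot],\alpha)$-module with respect to $\alpha_V$ (representation $\theta=0$) and also as the abelian multiplicative Hom-Lie triple system $(V,0,\alpha_V)$. Then there is a one-to-one correspondence between equivalence classes of central extensions of $(T,[\cdot,\cdot,\cdot],\alpha)$ by $(V,0,\alpha_V)$ and the elements of the third cohomology space $H^3_{\alpha,\alpha_V}(T,V)$.
   Context: **Multiplicative Hom-Lie triple system (Hom-LTS).** A triple $(T,[\cdot,\cdot,\cdot],\alpha)$ with $T$ an $\mathbf{F}$-vector space, a trilinear map $T\times T\times T\to T$, $(x,y,z)\mapsto[xyz]$, and a linear map $\alpha:T\to T$ such that for all $x,y,z,u,v\in T$: (1) $[xxz]=0$; (2) $[xyz]+[yzx]+[zxy]=0$; (3) $[\alpha(u)\alpha(v)[xyz]]=[[uvx]\alpha(y)\alpha(z)]+[\alpha(x)[uvy]\alpha(z)]+[\alpha(x)\alpha(y)[uvz]]$; (4) $\alpha([xyz])=[\alpha(x)\alpha(y)\alpha(z)]$. A morphism $f:(T,[\cdot,\cdot,\cdot],\alpha)\to(T',[\cdot,\cdot,\cdot]',\alpha')$ is a linear map with $f([xyz])=[f(x)f(y)f(z)]'$ and $f\circ\alpha=\alpha'\circ f$; an isomorphism is a bijective morphism. **Central extension.** A central extension of $(T,[\cdot,\cdot,\cdot],\alpha)$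 by $(V,0,\alpha_V)$ is a multiplicative Hom-LTS $(T_C,[\cdot,\cdot,\cdot]_C,\alpha_C)$ together with a short exact sequence of Hom-LTS morphisms $0\to V\xrightarrow{\iota}T_C\xrightarrow{\pi}T\to0$ (so in particular $\alpha_C\circ\iota=\iota\circ\alpha_V$ and $\alpha\circ\pi=\pi\circ\alpha_C$) such that there is a linear map $s:T\to T_C$ with $\pi s=\mathrm{id}_T$ and $\alpha_C\circ s=s\circ\alpha$, and such that $\iota(V)\subseteq Z(T_C)$, where $Z(T_C)=\{x\in T_C\mid [x,T_C,T_C]_C=0\}$ is the center of $T_C$. **Equivalence.** Two central extensions $(T_C,[\cdot,\cdot,\cdot]_C,\alpha_C)$ (with $\iota,\pi$) and $(T_C',[\cdot,\cdot,\cdot]_C',\alpha_C')$ (with $\iota',\pi'$) of $T$ by $V$ are equivalent if there is an isomorphism of Hom-LTSs $\varphi:(T_C,[\cdot,\cdot,\cdot]_C,\alpha_C)\to(T_C',[\cdot,\cdot,\cdot]_C',\alpha_C')$ with $\varphi\circ\iota=\iota'$ and $\pi'\circ\varphi=\pi$. **Cohomology with trivial coefficients, degree 3.** - $C^1_{\alpha,\alpha_V}(T,V)$ is the space of linear maps $f:T\to V$ with $\alpha_V\circ f=f\circ\alpha$. - $C^3_{\alpha,\alpha_V}(T,V)$ is the space of trilinear maps $g:T^3\to V$ with $\alpha_V(g(x,y,z))=g(\alpha(x),\alpha(y),\alpha(z))$, $g(x,x,z)=0$, and $g(x,y,z)+g(y,z,x)+g(z,x,y)=0$. - For $\theta=0$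 the coboundary operators are $(\delta^1_{hom}f)(x_1,x_2,x_3)=-f([x_1x_2x_3])$ and $$\begin{aligned}(\delta^3_{hom}g)(x_1,\dots,x_5)=\;&g([x_1x_2x_3],\alpha(x_4),\alpha(x_5))+g(\alpha(x_3),[x_1x_2x_4],\alpha(x_5))\\&+g(\alpha(x_3),\alpha(x_4),[x_1x_2x_5])-g(\alpha(x_1),\alpha(x_2),[x_3x_4x_5]).\end{aligned}$$ - $Z^3_{\alpha,\alpha_V}(T,V)=\{g\in C^3_{\alpha,\alpha_V}(T,V)\mid\delta^3_{hom}g=0\}$, $B^3_{\alpha,\alpha_V}(T,V)=\delta^1_{hom}C^1_{\alpha,\alpha_V}(T,V)$ (a subspace of $Z^3_{\alpha,\alpha_V}(T,V)$), and $H^3_{\alpha,\alpha_V}(T,V)=Z^3_{\alpha,\alpha_V}(T,V)/B^3_{\alpha,\alpha_V}(T,V)$. *)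

(* Defs.v *)
From HB Require Import structures.
From mathcomp Require Import all_boot all_order all_algebra.
From mathcomp Require Import boolp functions.

Set Implicit Arguments.
Unset Strict Implicit.
Unset Printing Implicit Defensive.

Import GRing.Theory.
Local Open Scope ring_scope.
Local Open Scope quotient_scope.

Definition trilinear (F : fieldType) (U V : lmodType F) (g : U -> U -> U -> V) :
    Prop :=
  [/\ forall y z, linear (fun x => g x y z),
      forall x z, linear (fun y => g x y z) &
      forall x y, linear (fun z => g x y z)].

(* Endomorphisms are taken in [{linear _ -> _}] rather than ['End(_)], since the
   underlying spaces may be infinite-dimensional. *)
Record homLTS (F : fieldType) := HomLTS {
  carrier :> lmodType F;
  br : carrier -> carrier -> carrier -> carrier;
  twist : {linear carrier -> carrier};
  br_trilinear : trilinear br;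
  br_alt : forall x z, br x x z = 0;
  br_cyclic : forall x y z, br x y z + br y z x + br z x y = 0;
  br_hom_nambu : forall x y z u v,
    br (twist u) (twist v) (br x y z) =
    br (br u v x) (twist y) (twist z) + br (twist x) (br u v y) (twist z)
    + br (twist x) (twist y) (br u v z);
  br_multiplicative : forall x y z,
    twist (br x y z) = br (twist x) (twist y) (twist z)
}.

Definition is_hom (F : fieldType) (S T : homLTS F) (f : {linear S -> T}) : Prop :=
  (forall x y z, f (br x y z) = br (f x) (f y) (f z)) /\
  (forall x, f (twist S x) = twist T (f x)).

Definition is_iso (F : fieldType) (S T : homLTS F) (f : {linear S -> T}) : Prop :=
  is_hom f /\ bijective f.

Definition center (F : fieldType) (T : homLTS F) (x : T) : Prop :=
  forall y z, br x y z = 0.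

Section Abelian.
Variables (F : fieldType) (V : lmodType F) (alphaV : {linear V -> V}).

Let br0 (_ _ _ : V) : V := 0.

Fact br0_trilinear : trilinear br0.
Proof. by split=> ? ? a u v; rewrite /br0 scaler0 addr0. Qed.

Fact br0_cyclic x y z : br0 x y z + br0 y z x + br0 z x y = 0.
Proof. by rewrite /br0 !addr0. Qed.

Fact br0_hom_nambu x y z u v :
  br0 (alphaV u) (alphaV v) (br0 x y z) =
  br0 (br0 u v x) (alphaV y) (alphaV z) + br0 (alphaV x) (br0 u v y) (alphaV z)
  + br0 (alphaV x) (alphaV y) (br0 u v z).
Proof. by rewrite /br0 !addr0. Qed.

Fact br0_multiplicative x y z :
  alphaV (br0 x y z) = br0 (alphaV x) (alphaV y) (alphaV z).
Proof. by rewrite /br0 linear0. Qed.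

Definition abelian_LTS : homLTS F :=
  HomLTS br0_trilinear (fun _ _ => erefl) br0_cyclic br0_hom_nambu
         br0_multiplicative.

End Abelian.

Section CentralExtensions.
Variables (F : fieldType) (T : homLTS F) (V : lmodType F).
Variable alphaV : {linear V -> V}.

Record central_ext := CentralExt {
  total :> homLTS F;
  ext_inj : {linear abelian_LTS alphaV -> total};
  ext_proj : {linear total -> T};
  ext_inj_hom : is_hom ext_inj;
  ext_proj_hom : is_hom ext_proj;
  ext_inj_injective : injective ext_inj;
  ext_exact : forall x, ext_proj x = 0 <-> exists v, ext_inj v = x;
  ext_proj_surjective : forall y, exists x, ext_proj x = y;
  ext_split : exists s : {linear T -> total},
    (forall y, ext_proj (s y) = y) /\
    (forall y, twist total (s y) = s (twist T y));
  ext_central : forall v, center (ext_inj v)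
}.

Definition ext_equiv (E E' : central_ext) : Prop :=
  exists phi : {linear E -> E'},
    [/\ is_iso phi,
        forall v, phi (ext_inj E v) = ext_inj E' v &
        forall x, ext_proj E' (phi x) = ext_proj E x].

Lemma ext_equiv_refl E : ext_equiv E E.
Proof. by exists idfun; split=> //; split=> //; exists idfun. Qed.

Lemma ext_equiv_sym E E' : ext_equiv E E' -> ext_equiv E' E.
Proof.
case=> f [[[fb fa] [g fK gK]] fi fp].
have g_lin : linear g.
  by move=> a u v; apply: (can_inj fK); rewrite linearP !gK.
pose gL : {linear E' -> E} := HB.pack g (GRing.isLinear.Build _ _ _ _ g g_lin).
exists gL; split=> [|v|x] /=.
- split; last by exists f.
  split=> [x y z|x] /=; apply: (can_inj fK).
    by rewrite fb !gK.
  by rewrite fa !gK.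
- by rewrite -fi fK.
- by rewrite -fp gK.
Qed.

Lemma ext_equiv_trans E1 E2 E3 :
  ext_equiv E1 E2 -> ext_equiv E2 E3 -> ext_equiv E1 E3.
Proof.
case=> f [[[fb fa] fbij] fi fp] [g [[[gb ga] gbij] gi gp]].
exists (g \o f : {linear _ -> _}); split=> [|v|x] /=.
- split; last exact: bij_comp.
  by split=> [x y z|x] /=; rewrite ?fb ?gb ?fa ?ga.
- by rewrite fi gi.
- by rewrite gp fp.
Qed.

(* [ext_equiv E], seen as a predicate, is the equivalence class of [E]. *)
Definition ext_class : Type :=
  {C : central_ext -> Prop | exists E, C = ext_equiv E}.

End CentralExtensions.

Section Cohomology.
Variables (F : fieldType) (T : homLTS F) (V : lmodType F).
Variable alphaV : {linear V -> V}.

Local Notation alpha := (twist T).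

Definition is_cochain1 (f : {linear T -> V}) : Prop :=
  forall x, alphaV (f x) = f (alpha x).

Definition is_cochain3 (g : T -> T -> T -> V) : Prop :=
  [/\ trilinear g,
      forall x y z, alphaV (g x y z) = g (alpha x) (alpha y) (alpha z),
      forall x z, g x x z = 0 &
      forall x y z, g x y z + g y z x + g z x y = 0].

(* Coboundaries for the trivial representation, theta = 0. *)
Definition delta1 (f : T -> V) (x1 x2 x3 : T) : V := - f (br x1 x2 x3).

Definition delta3 (g : T -> T -> T -> V) (x1 x2 x3 x4 x5 : T) : V :=
  g (br x1 x2 x3) (alpha x4) (alpha x5) + g (alpha x3) (br x1 x2 x4) (alpha x5)
  + g (alpha x3) (alpha x4) (br x1 x2 x5) - g (alpha x1) (alpha x2) (br x3 x4 x5).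

Definition is_cocycle3 (g : T -> T -> T -> V) : Prop :=
  is_cochain3 g /\ forall x1 x2 x3 x4 x5, delta3 g x1 x2 x3 x4 x5 = 0.

Definition is_coboundary3 (g : T -> T -> T -> V) : Prop :=
  exists2 f : {linear T -> V}, is_cochain1 f & g = delta1 f.

Lemma coboundary_cocycle g : is_coboundary3 g -> is_cocycle3 g.
Proof.
have [l1 l2 l3] := br_trilinear T.
case=> f fa ->; rewrite /is_cocycle3 /is_cochain3 /delta3 /delta1.
split; first split.
- split=> ? ? a u v.
  + by rewrite l1 linearP opprD scalerN.
  + by rewrite l2 linearP opprD scalerN.
  + by rewrite l3 linearP opprD scalerN.
- by move=> x y z; rewrite linearN fa br_multiplicative.
- by move=> x z; rewrite br_alt linear0 oppr0.
- by move=> x y z; rewrite -!opprD -!linearD br_cyclic linear0 oppr0.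
- move=> x1 x2 x3 x4 x5.
  by rewrite (br_hom_nambu x3) !linearD -!opprD subrr oppr0.
Qed.

Definition cocycle3 : {pred T -> T -> T -> V} := fun g => `[< is_cocycle3 g >].

Fact cocycle3_submod : submod_closed cocycle3.
Proof.
split.
  have E0 x y z : (0 : T -> T -> T -> V) x y z = 0 by [].
  apply/asboolP; split; first split.
  - by split=> ? ? a u v; rewrite !E0 scaler0 addr0.
  - by move=> x y z; rewrite !E0 linear0.
  - by [].
  - by move=> x y z; rewrite !E0 !addr0.
  - by move=> x1 x2 x3 x4 x5; rewrite /delta3 !E0 !addr0 subr0.
move=> a g h /asboolP[[[g1 g2 g3] ga gx gc] gd].
move=> /asboolP[[[h1 h2 h3] ha hx hc] hd].
have E x y z : (a *: g + h) x y z = a *: g x y z + h x y z by [].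
apply/asboolP; split; first split.
- split=> ? ? b u v.
  + by rewrite !E g1 h1 !scalerDr !scalerA mulrC addrACA.
  + by rewrite !E g2 h2 !scalerDr !scalerA mulrC addrACA.
  + by rewrite !E g3 h3 !scalerDr !scalerA mulrC addrACA.
- by move=> x y z; rewrite !E linearP ga ha.
- by move=> x z; rewrite E gx hx scaler0 addr0.
- move=> x y z; rewrite !E (addrACA (a *: _)) -scalerDr addrACA -scalerDr.
  by rewrite gc hc scaler0 addr0.
- move=> x1 x2 x3 x4 x5.
  transitivity (a *: delta3 g x1 x2 x3 x4 x5 + delta3 h x1 x2 x3 x4 x5).
    rewrite /delta3 !E scalerBr !scalerDr opprD.
    rewrite [RHS]addrACA; congr (_ + _); rewrite [RHS]addrACA; congr (_ + _).
    by rewrite [RHS]addrACA.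
  by rewrite gd hd scaler0 addr0.
Qed.

HB.instance Definition _ :=
  GRing.isSubmodClosed.Build F (T -> T -> T -> V) cocycle3 cocycle3_submod.

Record Z3 := MkZ3 { Z3val :> T -> T -> T -> V; _ : Z3val \in cocycle3 }.

HB.instance Definition _ := [isSub for Z3val].
HB.instance Definition _ := [Choice of Z3 by <:].
HB.instance Definition _ := [SubChoice_isSubLmodule of Z3 by <:].

Definition B3 : {pred Z3} := fun g => `[< is_coboundary3 (Z3val g) >].

Fact B3_submod : submod_closed B3.
Proof.
split.
  apply/asboolP; exists \0; first by move=> x /=; rewrite linear0.
  by apply/funext=> x; apply/funext=> y; apply/funext=> z; rewrite /delta1 oppr0.
move=> a g h /asboolP[f fa gE] /asboolP[k ka hE]; apply/asboolP.
have l_lin : linear (fun x => a *: f x + k x).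
  move=> b u v; rewrite (linearP f) (linearP k) !scalerDr !scalerA [b * a]mulrC.
  by rewrite addrACA.
pose l : {linear T -> V} := HB.pack (fun x => a *: f x + k x)
  (GRing.isLinear.Build _ _ _ _ _ l_lin).
exists l; first by move=> x /=; rewrite linearP fa ka.
apply/funext=> x; apply/funext=> y; apply/funext=> z.
transitivity (a *: Z3val g x y z + Z3val h x y z); first by [].
by rewrite gE hE /delta1 /= scalerN opprD.
Qed.

HB.instance Definition _ := GRing.isSubmodClosed.Build F Z3 B3 B3_submod.

Definition H3 : Type := Quotient.quot B3.

HB.instance Definition _ := GRing.Zmodule.on H3.
HB.instance Definition _ : EqQuotient Z3 (Quotient.equiv B3) H3 :=
  EqQuotient.on H3.

(* The library quotient carries only the additive structure. *)
Definition H3scale (a : F) : H3 -> H3 := lift_op1 H3 ( *:%R a).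

Fact pi_H3scale a : {morph \pi_H3 : x / a *: x >-> H3scale a x}.
Proof.
move=> x; unlock H3scale; apply/eqP; rewrite piE Quotient.equivE.
by rewrite -scalerBr rpredZ // Quotient.idealrBE reprK.
Qed.

Canonical pi_H3scale_morph a := PiMorph1 (pi_H3scale a).

Fact H3scaleA a b x : H3scale a (H3scale b x) = H3scale (a * b) x.
Proof. by rewrite -[x]reprK !piE scalerA. Qed.

Fact H3scale1 : left_id 1 H3scale.
Proof. by move=> x; rewrite -[x]reprK !piE scale1r. Qed.

Fact H3scaleDr : right_distributive H3scale +%R.
Proof. by move=> a x y; rewrite -[x]reprK -[y]reprK !piE scalerDr. Qed.

Fact H3scaleDl x : {morph H3scale^~ x : a b / a + b}.
Proof. by move=> a b; rewrite -[x]reprK !piE scalerDl. Qed.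

HB.instance Definition _ :=
  GRing.Zmodule_isLmodule.Build F H3 H3scaleA H3scale1 H3scaleDr H3scaleDl.

End Cohomology.

(* Main.v *)
From HB Require Import structures.
Require Import Defs.
From mathcomp Require Import all_boot all_order all_algebra.
From mathcomp Require Import boolp functions.

(** A cocycle [g] twists the bracket of [T * V] into
    [[(x, u), (y, v), (z, w)] = ([x y z], g x y z)], which gives a central
    extension. Conversely a twist-compatible section [s] of a central extension
    determines a linear retraction [r] onto [V] with [iota (r x) = x - s (pi x)];
    then [g x y z = r [s x, s y, s z]] is a cocycle, and [x |-> (pi x, r x)]
    identifies the extension with the one twisted by [g]. An equivalence between
    two twisted extensions has the form [(x, v) |-> (x, f x + v)], and it respects
    the brackets iff the two cocycles differ by the coboundary of [f]. *)

Set Implicit Arguments.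
Unset Strict Implicit.
Unset Printing Implicit Defensive.

Import GRing.Theory.
Local Open Scope ring_scope.
Local Open Scope quotient_scope.

Section Trilinear.
Variables (F : fieldType) (U V : lmodType F) (g : U -> U -> U -> V).
Hypothesis gtri : trilinear g.

Lemma trilinearD1 x x' y z : g (x + x') y z = g x y z + g x' y z.
Proof. by have [l _ _] := gtri; have := l y z 1 x x'; rewrite !scale1r. Qed.

Lemma trilinearD2 x y y' z : g x (y + y') z = g x y z + g x y' z.
Proof. by have [_ l _] := gtri; have := l x z 1 y y'; rewrite !scale1r. Qed.

Lemma trilinearD3 x y z z' : g x y (z + z') = g x y z + g x y z'.
Proof. by have [_ _ l] := gtri; have := l x y 1 z z'; rewrite !scale1r. Qed.

Lemma trilinear01 y z : g 0 y z = 0.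
Proof. by apply: (@addrI _ (g 0 y z)); rewrite -trilinearD1 !addr0. Qed.

End Trilinear.

(** * Insensitivity of the bracket to central summands *)

Section BracketModuloCenter.
Variables (F : fieldType) (T : homLTS F) (c : T).
Hypothesis cc : center c.

(** [center] only constrains the first argument; polarizing the alternating law at [x + c] carries
    the vanishing to the second, and the cyclic identity then carries it to the third. *)
Lemma br_center2 x y : br x c y = 0.
Proof.
have := br_alt (x + c) y.
rewrite (trilinearD1 (br_trilinear T)) cc addr0.
by rewrite (trilinearD2 (br_trilinear T)) br_alt add0r.
Qed.

Lemma br_center3 x y : br x y c = 0.
Proof. by have := br_cyclic x y c; rewrite br_center2 cc !addr0. Qed.

Lemma br_addc1 x y z : br (x + c) y z = br x y z.
Proof. by rewrite (trilinearD1 (br_trilinear T)) cc addr0. Qed.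

Lemma br_addc2 x y z : br x (y + c) z = br x y z.
Proof. by rewrite (trilinearD2 (br_trilinear T)) br_center2 addr0. Qed.

Lemma br_addc3 x y z : br x y (z + c) = br x y z.
Proof. by rewrite (trilinearD3 (br_trilinear T)) br_center3 addr0. Qed.

End BracketModuloCenter.

(** * The central extension built from a cocycle *)

Section TwistedExtension.
Variables (F : fieldType) (T : homLTS F) (V : lmodType F).
Variables (alphaV : {linear V -> V}) (g : T -> T -> T -> V).
Hypothesis gZ : is_cocycle3 alphaV g.

Local Notation alpha := (twist T).

Definition twisted_br (p q r : T * V) : T * V :=
  (br p.1 q.1 r.1, g p.1 q.1 r.1).

Definition twisted_twist (p : T * V) : T * V := (alpha p.1, alphaV p.2).

Fact twisted_twist_linear : linear twisted_twist.
Proof. by move=> a p q; rewrite /twisted_twist /= !linearP. Qed.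

HB.instance Definition _ :=
  GRing.isLinear.Build F (T * V)%type (T * V)%type _ twisted_twist
    twisted_twist_linear.

Fact twisted_br_trilinear : trilinear twisted_br.
Proof.
have [l1 l2 l3] := br_trilinear T; have [[[g1 g2 g3] _ _ _] _] := gZ.
split=> ? ? a u v; rewrite /twisted_br /=.
- by rewrite l1 g1.
- by rewrite l2 g2.
- by rewrite l3 g3.
Qed.

Fact twisted_br_alt p q : twisted_br p p q = 0.
Proof. by have [[_ _ ga _] _] := gZ; rewrite /twisted_br br_alt ga. Qed.

Fact twisted_br_cyclic p q r :
  twisted_br p q r + twisted_br q r p + twisted_br r p q = 0.
Proof.
have [[_ _ _ gc] _] := gZ.
by congr (_, _); [exact: br_cyclic | exact: gc].
Qed.

Fact twisted_br_hom_nambu x y z u v :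
  twisted_br (twisted_twist u) (twisted_twist v) (twisted_br x y z) =
  twisted_br (twisted_br u v x) (twisted_twist y) (twisted_twist z)
  + twisted_br (twisted_twist x) (twisted_br u v y) (twisted_twist z)
  + twisted_br (twisted_twist x) (twisted_twist y) (twisted_br u v z).
Proof.
have [_ gd] := gZ; congr (_, _); first exact: br_hom_nambu.
(* On the [V] component the identity is [delta3 g u v x y z = 0] with its negative term moved
   across. *)
by apply/esym/eqP; rewrite -subr_eq0; apply/eqP/gd.
Qed.

Fact twisted_br_multiplicative x y z :
  twisted_twist (twisted_br x y z) =
  twisted_br (twisted_twist x) (twisted_twist y) (twisted_twist z).
Proof.
have [[_ gm _ _] _] := gZ.
by rewrite /twisted_twist /twisted_br /= br_multiplicative gm.
Qed.

Definition twisted_LTS : homLTS F :=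
  @HomLTS F (T * V)%type twisted_br twisted_twist twisted_br_trilinear
    twisted_br_alt twisted_br_cyclic twisted_br_hom_nambu
    twisted_br_multiplicative.

Definition twisted_inj (v : abelian_LTS alphaV) : twisted_LTS := (0, v).
Definition twisted_proj (p : twisted_LTS) : T := p.1.
Definition twisted_section (x : T) : twisted_LTS := (x, 0).

Fact twisted_inj_linear : linear twisted_inj.
Proof. by move=> a u v; congr (_, _); rewrite /= scaler0 addr0. Qed.

Fact twisted_proj_linear : linear twisted_proj.
Proof. by []. Qed.

Fact twisted_section_linear : linear twisted_section.
Proof. by move=> a u v; congr (_, _); rewrite /= scaler0 addr0. Qed.

HB.instance Definition _ :=
  GRing.isLinear.Build F _ _ _ twisted_inj twisted_inj_linear.
HB.instance Definition _ :=
  GRing.isLinear.Build F _ _ _ twisted_proj twisted_proj_linear.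
HB.instance Definition _ :=
  GRing.isLinear.Build F _ _ _ twisted_section twisted_section_linear.

Fact twisted_inj_center v : center (twisted_inj v).
Proof.
have [[gtri _ _ _] _] := gZ.
move=> p q; congr (_, _); last exact: trilinear01 gtri _ _.
exact: trilinear01 (br_trilinear T) _ _.
Qed.

Fact twisted_inj_hom : is_hom twisted_inj.
Proof.
split=> [x y z|x]; last by congr (_, _); rewrite /= linear0.
(* The bracket of [V] is zero, so compatibility with brackets is a case of centrality. *)
exact/esym/twisted_inj_center.
Qed.

Fact twisted_proj_hom : is_hom twisted_proj.
Proof. by []. Qed.

Fact twisted_inj_injective : injective twisted_inj.
Proof. by move=> u v []. Qed.

Fact twisted_exact p : twisted_proj p = 0 <-> exists v, twisted_inj v = p.
Proof.
split=> [|[v <-] //]; case: p => x v /= px0; exists v.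
by congr (_, _); rewrite -px0.
Qed.

Fact twisted_proj_surjective y : exists p, twisted_proj p = y.
Proof. by exists (twisted_section y). Qed.

Fact twisted_split : exists s : {linear T -> twisted_LTS},
  (forall y, twisted_proj (s y) = y) /\
  (forall y, twist twisted_LTS (s y) = s (alpha y)).
Proof.
exists twisted_section; split=> // y.
by congr (_, _); rewrite /= linear0.
Qed.

Definition twisted_ext : central_ext T alphaV :=
  CentralExt twisted_inj_hom twisted_proj_hom twisted_inj_injective
    twisted_exact twisted_proj_surjective twisted_split twisted_inj_center.

End TwistedExtension.

(** * Equivalence classes of extensions against cohomology classes *)

Section Classification.
Variables (F : fieldType) (T : homLTS F) (V : lmodType F).
Variable alphaV : {linear V -> V}.

Local Notation alpha := (twist T).

Lemma twisted_ext_equiv (g h : T -> T -> T -> V)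
    (gZ : is_cocycle3 alphaV g) (hZ : is_cocycle3 alphaV h) :
  ext_equiv (twisted_ext gZ) (twisted_ext hZ) <->
  is_coboundary3 alphaV (fun x y z => g x y z - h x y z).
Proof.
split=> [[phi [[[phib phia] _] phii phip]]|[f fa ghE]].
  pose f0 (x : T) : V := (phi (twisted_section gZ x)).2.
  have f_lin : linear f0 by move=> a x y; rewrite /f0 !linearP.
  pose f : {linear T -> V} := HB.pack f0 (GRing.isLinear.Build _ _ _ _ f0 f_lin).
  (* Compatibility with the projections fixes the first component, and compatibility with the
     injections fixes [phi] on [V]; only [f] remains free. *)
  have phiE x v : phi (x, v) = (x, f x + v).
    have -> : (x, v) = twisted_section gZ x + twisted_inj gZ v.
      by congr (_, _); rewrite /= ?addr0 ?add0r.
    rewrite linearD [phi (twisted_inj gZ v)]phii.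
    have := phip (twisted_section gZ x); rewrite /f /= /f0.
    by case: (phi _) => y w /= ->; congr (_, _); rewrite /= addr0.
  exists f => [x|].
    have := phia (twisted_section gZ x).
    rewrite /= /twisted_twist /twisted_section /= !phiE /= linear0 !addr0.
    by case.
  (* Comparing [V] components of the bracket condition on the section gives [f [x y z] + g x y z = h
     x y z]. *)
  apply/funext=> x; apply/funext=> y; apply/funext=> z.
  have := phib (twisted_section gZ x) (twisted_section gZ y)
               (twisted_section gZ z).
  rewrite /= /twisted_br /twisted_section /= !phiE /=.
  by case=> <-; rewrite /delta1 opprD addrCA subrr addr0.
have ghE' x y z : g x y z - h x y z = - f (br x y z).
  by rewrite -[RHS]/(delta1 f x y z) -ghE.
pose phi0 (p : twisted_ext gZ) : twisted_ext hZ := (p.1, f p.1 + p.2).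
have phi_lin : linear phi0.
  move=> a p q; congr (_, _) => /=.
  by rewrite linearP /= scalerDr addrACA.
pose phi : {linear twisted_ext gZ -> twisted_ext hZ} :=
  HB.pack phi0 (GRing.isLinear.Build _ _ _ _ phi0 phi_lin).
exists phi; split=> [|v|//]; last by congr (_, _); rewrite /= linear0 add0r.
split.
  split=> [p q r|p]; congr (_, _) => /=; last by rewrite linearD fa.
  by rewrite -[f _]opprK -ghE' opprB subrK.
(* The inverse is the shear by [- f]. *)
exists (fun p => (p.1, p.2 - f p.1)) => -[x v]; congr (_, _) => /=.
  by rewrite addrC addKr.
by rewrite addrC subrK.
Qed.

Lemma central_ext_twisted (E : central_ext T alphaV) :
  exists (g : T -> T -> T -> V) (gZ : is_cocycle3 alphaV g),
    ext_equiv E (twisted_ext gZ).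
Proof.
have [s [sK sa]] := ext_split E.
have [pb pa] := ext_proj_hom E; have [_ ia] := ext_inj_hom E.
have icen := @ext_central _ _ _ _ E.
have iI := @ext_inj_injective _ _ _ _ E.
set i := ext_inj E in ia icen iI *; set p := ext_proj E in pb pa sK *.
have pi0 v : p (i v) = 0 by apply: (proj2 (ext_exact _)); exists v.
(* By exactness, [x - s (p x)] comes from [V]. Identities for the retraction are then checked after
   applying the injective map [i]. *)
have /choice[r0 r0E] x : exists v : V, i v = x - s (p x).
  by apply: (proj1 (ext_exact _)); rewrite linearB /= -/p sK subrr.
have r_lin : linear r0.
  move=> a x y; apply: iI; rewrite linearP !r0E (linearP p) (linearP s).
  by rewrite scalerBr opprD addrACA.
pose r : {linear E -> V} := HB.pack r0 (GRing.isLinear.Build _ _ _ _ r0 r_lin).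
have rE x : i (r x) = x - s (p x) by exact: r0E.
have rs x : r (s x) = 0 by apply: iI; rewrite rE sK subrr linear0.
have ri v : r (i v) = v by apply: iI; rewrite rE pi0 linear0 subr0.
have ra x : alphaV (r x) = r (twist E x).
  by apply: iI; rewrite rE pa -sa -linearB -rE -ia.
have decomp x : x = s (p x) + i (r x) by rewrite rE addrC subrK.
pose g x y z := r (br (s x) (s y) (s z)).
(* Each argument differs from its image under [s \o p] by a central element. *)
have brE x y z : br x y z = br (s (p x)) (s (p y)) (s (p z)).
  by rewrite [in LHS](decomp x) [in LHS](decomp y) [in LHS](decomp z)
    br_addc1 ?br_addc2 ?br_addc3.
have gE x y z : r (br x y z) = g (p x) (p y) (p z) by rewrite brE.
have gZ : is_cocycle3 alphaV g.
  have [l1 l2 l3] := br_trilinear E.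
  split; first split.
  - split=> ? ? a u v; rewrite /g.
    + by rewrite linearP l1 linearP.
    + by rewrite linearP l2 linearP.
    + by rewrite linearP l3 linearP.
  - by move=> x y z; rewrite /g ra br_multiplicative !sa.
  - by move=> x z; rewrite /g br_alt linear0.
  - by move=> x y z; rewrite /g -!linearD br_cyclic linear0.
  move=> x1 x2 x3 x4 x5; rewrite /delta3.
  (* Writing every argument of [g] as a value of [p] lets [gE] turn [delta3 g] into [r] applied to
     the Hom-Nambu identity of [E]. *)
  have E3 x y z : br x y z = p (br (s x) (s y) (s z)) by rewrite pb !sK.
  have Ea x : alpha x = p (twist E (s x)) by rewrite pa sK.
  by rewrite !E3 !Ea -!gE (br_hom_nambu (s x3)) !(linearD r) subrr.
exists g, gZ.
pose phi0 (x : E) : twisted_ext gZ := (p x, r x).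
have phi_lin : linear phi0 by move=> a x y; rewrite /phi0 !linearP.
pose phi : {linear E -> twisted_ext gZ} :=
  HB.pack phi0 (GRing.isLinear.Build _ _ _ _ phi0 phi_lin).
exists phi; split=> [|v|//]; last by congr (_, _); [exact: pi0 | exact: ri].
split.
  split=> [x y z|x]; congr (_, _); [exact: pb | exact: gE | exact: pa |].
  by rewrite /= ra.
exists (fun q : T * V => s q.1 + i q.2) => [x|[x v]].
  by rewrite /= -decomp.
have peq : p (s x + i v) = x by rewrite linearD sK pi0 addr0.
have req : r (s x + i v) = v by rewrite linearD rs ri add0r.
by rewrite /= /phi0 peq req.
Qed.

Lemma Z3P (g : Z3 T alphaV) : is_cocycle3 alphaV g.
Proof. exact/asboolP/(valP g). Qed.

Definition cocycle_class (g : Z3 T alphaV) : ext_class T alphaV :=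
  exist _ (ext_equiv (twisted_ext (Z3P g))) (ex_intro _ _ erefl).

Lemma ext_equivE (E E' : central_ext T alphaV) :
  ext_equiv E = ext_equiv E' <-> ext_equiv E E'.
Proof.
split=> [->|EE']; first exact: ext_equiv_refl.
apply/funext=> D; apply/propext; split; apply: ext_equiv_trans => //.
exact: ext_equiv_sym.
Qed.

(** From right to left, this makes the class of the twisted extension depend only on the cohomology
    class; from left to right, it gives injectivity. *)
Lemma cocycle_class_eq (g h : Z3 T alphaV) :
  cocycle_class g = cocycle_class h <-> \pi_(H3 T alphaV) g = \pi_(H3 T alphaV) h.
Proof.
have -> : (\pi_(H3 T alphaV) g = \pi_(H3 T alphaV) h) <->
    is_coboundary3 alphaV (fun x y z => g x y z - h x y z).
  have piB : (\pi_(H3 T alphaV) g == \pi_(H3 T alphaV) h) =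
      (g - h \in @B3 F T V alphaV).
    by rewrite piE Quotient.equivE.
  split=> [/eqP|cob]; first by rewrite piB => /asboolP.
  by apply/eqP; rewrite piB; apply/asboolP.
rewrite -(twisted_ext_equiv (Z3P g) (Z3P h)) -ext_equivE.
split; [by case | exact: eq_exist].
Qed.

Lemma cocycle_class_surj (C : ext_class T alphaV) :
  exists g, cocycle_class g = C.
Proof.
case: C => C [E CE]; have [g [gZ Eg]] := central_ext_twisted E.
have gin : g \in @cocycle3 F T V alphaV by apply/asboolP.
exists (MkZ3 gin); apply: eq_exist; rewrite CE; apply/ext_equivE.
(* [twisted_ext] takes the cocycle proof as an argument, so the two proofs must be identified. *)
rewrite (Prop_irrelevance (Z3P (MkZ3 gin)) gZ).
exact: ext_equiv_sym.
Qed.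

End Classification.

Theorem theorem3p1 (F : fieldType) (T : homLTS F) (V : lmodType F)
    (alphaV : {linear V -> V}) :
  exists Phi : ext_class T alphaV -> H3 T alphaV, bijective Phi.
Proof.
(* [c] chooses a cocycle for each extension class; its cohomology class does not depend on the
   choice, by [cocycle_class_eq]. *)
have /choice[c cK] := @cocycle_class_surj F T V alphaV.
exists (fun C => \pi_(H3 T alphaV) (c C)), (fun h => cocycle_class (repr h)) => [C|h].
  by rewrite -[RHS]cK; apply/cocycle_class_eq; rewrite reprK.
by rewrite -[RHS]reprK; apply/cocycle_class_eq/cK.
Qed.
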